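(* Let $\sigma=\sigma_{l,r}=\sigma_1\cdots\sigma_n$ be any turn sequence with $l$ left turns and $r$ right turns, $l-r\ge 0$, such that some point of the $-x$-axis is reachable by $\sigma$. Then $x^-_{l,r}$ satisfies the following lower bounds: (1) if $l-r\equiv 0$ or $1\pmod 4$, then $x^-_{l,r}\ge\left|\left\lfloor\frac{l-r+2}{4}\right\rfloor-1\right|+1$; (2) if $l-r\equiv 2\pmod 4$, then $x^-_{l,r}\ge\left|\left\lfloor\frac{l-r+2}{4}\right\rfloor-2\right|+2$ if $\sigma_n=\texttt{L}$, and $x^-_{l,r}\ge\left\lfloor\frac{l-r+2}{4}\right\rfloor+1$ if $\sigma_n=\texttt{R}$; (3) if $l-r\equiv 3\pmod 4$, then $x^-_{l,r}\ge\left\lfloor\frac{l-r+2}{4}\right\rfloor$.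
   Context: A turn sequence is a finite word $\sigma=\sigma_1\cdots\sigma_n$ with $\sigma_i\in\{\texttt{L},\texttt{R}\}$ (left turn, right turn); $\sigma_{l,r}$ denotes a turn sequence with $l$ left turns and $r$ right turns, $n=l+r$. A rectilinear chain realizes $\sigma$ if it is simple (no self-intersection), consists of $n+1$ axis-parallel segments of positive integer length, starts at the origin $o=(0,0)$ with its first segment heading east (direction $+x$), and at its $n$ successive bends makes the $90^\circ$ turns $\sigma_1,\dots,\sigma_n$ in order. Its endpoint $p\in\mathbb{Z}^2$ is said to be reachable by $\sigma$. The $-x$-axis is $\{(a,0):a<0\}$. If $\sigma$ reaches the $-x$-axis, $(x^-_\sigma,0)$ denotes the point of the $-x$-axis reachable by $\sigma$ that is closest to $o$ (so $x^-_\sigma<0$). The quantity $x^-_{l,r}$ is the maximum $x^-_{l,r}=\max_{\sigma_{l,r}}|x^-_{\sigma_{l,r}}|$ over all turn sequences $\sigma_{l,r}$ with $l$ left turns and $r$ right turns (for which $x^-_{\sigma_{l,r}}$ exists). *)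

(* Defs.v *)
From HB Require Import structures.
From mathcomp Require Import all_boot all_order all_algebra.
From mathcomp Require Import boolp reals.

Set Implicit Arguments.
Unset Strict Implicit.
Unset Printing Implicit Defensive.

Import Order.TTheory GRing.Theory Num.Theory.
Local Open Scope ring_scope.

Inductive turn := TurnL | TurnR.

Definition bool_of_turn (t : turn) : bool := if t is TurnL then true else false.
Definition turn_of_bool (b : bool) : turn := if b then TurnL else TurnR.
Lemma bool_of_turnK : cancel bool_of_turn turn_of_bool.
Proof. by case. Qed.

HB.instance Definition _ := Finite.copy turn (can_type bool_of_turnK).

Definition point : Type := (int * int)%type.

(* Rotation of a direction vector by +90 (left) or -90 (right) degrees. *)
Definition turn_dir (d : point) (t : turn) : point :=
  match t with
  | TurnL => (- d.2, d.1)
  | TurnR => (d.2, - d.1)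
  end.

Definition headings (s : seq turn) : seq point :=
  (1, 0) :: scanl turn_dir (1, 0) s.

(* Segment i of the chain is [ms]_i times the i-th heading; the vertex list
   starts with the origin and ends with the endpoint of the chain. *)
Definition vertices (s : seq turn) (ms : seq nat) : seq point :=
  (0, 0) :: scanl +%R (0, 0) [seq dm.1 *+ dm.2 | dm <- zip (headings s) ms].

(* [z] lies on the closed segment of the real plane joining [a] and [b]. *)
Definition on_segment (R : realType) (a b : point) (z : R * R) : Prop :=
  exists2 t : R, 0 <= t <= 1 &
    z = (a.1%:~R + t * (b.1 - a.1)%:~R, a.2%:~R + t * (b.2 - a.2)%:~R).

(* Two distinct segments of the polygonal chain with vertex list [v] meet only
   if they are consecutive, and then only at their common vertex. *)
Definition simple_chain (R : realType) (v : seq point) : Prop :=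
  forall (i j : nat) (z : R * R), (i < j)%N -> (j.+1 < size v)%N ->
    on_segment v`_i v`_i.+1 z -> on_segment v`_j v`_j.+1 z ->
    j = i.+1 /\ z = ((v`_j).1%:~R, (v`_j).2%:~R).

Definition realizes (R : realType) (s : seq turn) (ms : seq nat) : Prop :=
  [/\ size ms = (size s).+1, all (fun m => 0 < m)%N ms
    & simple_chain R (vertices s ms)].

Definition reachable (R : realType) (s : seq turn) (p : point) : Prop :=
  exists2 ms : seq nat, realizes R s ms & last (0, 0) (vertices s ms) = p.

Definition reaches_negx (R : realType) (s : seq turn) : Prop :=
  exists2 a : int, a < 0 & reachable R s (a, 0).

Lemma reaches_negx_nat (R : realType) (s : seq turn) :
  reaches_negx R s ->
  exists k : nat, `[< (0 < k)%N /\ reachable R s (- k%:Z, 0) >].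
Proof.
case=> a a0 ra; exists `|a|%N; apply/asboolP; split.
  by rewrite absz_gt0 lt_eqF.
by rewrite ltz0_abs ?opprK.
Qed.

(* The abscissa of the point of the open negative x-axis reachable by [s] that
   is closest to the origin (and 0 when there is no such point). *)
Definition xneg (R : realType) (s : seq turn) : int :=
  match pselect (reaches_negx R s) with
  | left h => - (ex_minn (reaches_negx_nat h))%:Z
  | right _ => 0
  end.

Lemma xnegP (R : realType) (s : seq turn) : reaches_negx R s ->
  [/\ xneg R s < 0, reachable R s (xneg R s, 0)
    & forall a : int, a < 0 -> reachable R s (a, 0) -> a <= xneg R s].
Proof.
move=> h; rewrite /xneg; case: pselect => // h'.
case: ex_minnP => k /asboolP[k0 rk] kmin; split => //.
  by rewrite oppr_lt0.
move=> a a0 ra; rewrite lerNr.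
have ea : - a = `|a|%N%:Z by rewrite ltz0_abs.
rewrite ea lez_nat; apply: kmin; apply/asboolP; split.
  by rewrite absz_gt0 lt_eqF.
by rewrite -ea opprK.
Qed.

(* The maximum over the (finitely many) turn sequences with [l] left and [r]
   right turns that reach the negative x-axis (0 if there are none). *)
Definition xneg_max (R : realType) (l r : nat) : nat :=
  \max_(s : (l + r).-tuple turn |
        [&& count_mem TurnL s == l, count_mem TurnR s == r
          & `[< reaches_negx R s >]]) `|xneg R s|%N.

(* Main.v *)
Require Import Defs.
From HB Require Import structures.
From mathcomp Require Import all_boot all_order all_algebra.
From mathcomp Require Import boolp reals.
From mathcomp Require Import zify ring lra.

(** For each residue of [l - r] one explicit word already satisfies the bound: a
staircase [(LR)^j], a left spiral [L^(4k+1)], and at most five further turns.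

Lower bound for that word.  Follow the chain turn after turn.  As long as the
spiral winds outward, each full turn crosses the negative x-axis southward
strictly further left than the previous one.  As soon as it fails to wind
outward it is caught in a pocket bounded by its own last segments, and each
further turn shrinks the pocket strictly; the pocket either lies to the left of
all earlier crossings or misses the negative x-axis altogether.

Realizability.  Any word can be drawn so that the chain always ends strictly
ahead of all its earlier vertices; the last turns are then placed by hand, far
to the left.

When [r] is too small for the explicit word, no word with these numbers of turns
(and ending in L, if [l - r = 2]) reaches the negative x-axis: some heading is missing, or, for [RLLL], the last
segment would run through the origin. *)

Set Implicit Arguments.
Unset Strict Implicit.
Unset Printing Implicit Defensive.

Import Order.TTheory GRing.Theory Num.Theory.
Local Open Scope ring_scope.

(** * Integral model of chains *)

(* Vertices are integral and segments axis-parallel, so two segments meet in the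
   real plane iff their boxes share an integral point. *)
Definition box (a b q : point) : bool :=
  ((a.1 <= q.1 <= b.1) || (b.1 <= q.1 <= a.1)) &&
  ((a.2 <= q.2 <= b.2) || (b.2 <= q.2 <= a.2)).

(* Vertex lists and turn words are reversed from here on: the endpoint of the
   chain and the last turn come first. *)
Fixpoint occ (l : seq point) (q : point) : bool :=
  if l is a :: l' then
    (if l' is b :: _ then box a b q else false) || occ l' q
  else false.

(** Adjacent segments are exempt: in a chain they are perpendicular, so they share only their common
    vertex. *)
Fixpoint noncrossing (l : seq point) : Prop :=
  if l is a :: l' then
    (if l' is b :: l'' then forall q, box a b q -> ~~ occ l'' q else True)
      /\ noncrossing l'
  else True.

Fixpoint heading (w : seq turn) : point :=
  if w is t :: w' then turn_dir (heading w') t else (1, 0).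

Definition shift (p h : point) (m : int) : point :=
  (p.1 + h.1 * m, p.2 + h.2 * m).

Fixpoint chain (w : seq turn) (l : seq point) : Prop :=
  if w is t :: w' then
    exists p l' m, [/\ chain w' (p :: l'), 0 < m
                     & l = shift p (heading w) m :: p :: l']
  else exists2 m, 0 < m & l = [:: (m, 0); (0, 0)].

(** * Agreement of the integral model with [reachable] *)

Lemma boxC a b q : box a b q = box b a q.
Proof. by rewrite /box orbC; congr (_ && _); rewrite orbC. Qed.

Lemma heading_rev s : foldl turn_dir (1, 0) s = heading (rev s).
Proof.
by elim/last_ind: s => // s t IH; rewrite foldl_rcons rev_rcons IH.
Qed.

Lemma headings_rcons s t :
  headings (rcons s t) = rcons (headings s) (heading (rev (rcons s t))).
Proof. by rewrite /headings scanl_rcons heading_rev. Qed.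

Lemma size_headings s : size (headings s) = (size s).+1.
Proof. by rewrite /= size_scanl. Qed.

Lemma mulrn_pair (h : point) (m : nat) : h *+ m = (h.1 *+ m, h.2 *+ m).
Proof. by elim: m => [|m IH]; rewrite ?mulrS // IH. Qed.

Lemma last_scanl (T U : Type) (f : T -> U -> T) x s :
  last x (scanl f x s) = foldl f x s.
Proof. by elim: s x => //= y s IH x; rewrite IH. Qed.

Lemma vertices_rcons s ms t m : size ms = (size s).+1 ->
  vertices (rcons s t) (rcons ms m) =
  rcons (vertices s ms)
    (shift (last (0, 0) (vertices s ms)) (heading (rev (rcons s t))) m%:Z).
Proof.
move=> sz; rewrite /vertices headings_rcons zip_rcons ?size_headings ?sz //.
rewrite map_rcons scanl_rcons -rcons_cons; congr rcons.
rewrite -cats1 foldl_cat /= last_scanl mulrn_pair /shift.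
by rewrite /= !pmulrn !mulrzz.
Qed.

Lemma chainP s v : chain (rev s) (rev v) <->
  exists ms, [/\ size ms = (size s).+1, all (fun m => 0 < m)%N ms
               & vertices s ms = v].
Proof.
elim/last_ind: s v => [|s t IH] v.
  split=> [[m m0 e]|[ms [sz ps <-]]].
    exists [:: `|m|%N]; split=> //=; first by lia.
    rewrite -(revK v) e /vertices /= mulrn_pair add0r /=.
    by rewrite mul0rn natz gtz0_abs.
  case: ms sz ps => [|m [|m' ms]] //= _ /andP[m0 _].
  exists m%:Z; first by lia.
  by rewrite /vertices /= mulrn_pair add0r /= mul0rn natz rev_cons.
rewrite rev_rcons; split=> [/= [p [l' [m [c m0 e]]]]|[ms [sz ps <-]]].
  have [] := (IH (rev (p :: l'))).1; first by rewrite revK.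
  move=> ms [sz ps ve]; exists (rcons ms `|m|%N); split.
  - by rewrite !size_rcons sz.
  - by rewrite all_rcons ps andbT; lia.
  rewrite vertices_rcons // ve -(revK v) e [in RHS]rev_cons; congr rcons.
  by rewrite rev_cons last_rcons rev_rcons /=; congr (shift _ _ _); lia.
case/lastP: ms sz ps => [|ms m] //; rewrite !size_rcons => -[sz].
rewrite all_rcons => /andP[m0 ps].
rewrite vertices_rcons // rev_rcons.
have := (IH (vertices s ms)).2 (ex_intro _ ms (And3 sz ps erefl)).
case/lastP: (vertices s ms) => [|v' p]; rewrite ?rev_rcons.
  by case: (rev s) => [[m' _]|? ? [? [? [? []]]]].
move=> c; exists p, (rev v'), m%:Z; split => //.
by rewrite last_rcons.
Qed.

Definition btw (x y z : int) : bool := (x <= z <= y) || (y <= z <= x).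

Lemma btw_param (R : realType) (x y z : int) : btw x y z ->
  exists2 t : R, 0 <= t <= 1 & z%:~R = x%:~R + t * (y - x)%:~R.
Proof.
move=> h; have [e|ne] := eqVneq x y.
  exists 0; first by rewrite lexx ler01.
  by rewrite mul0r addr0; congr (_%:~R); move: h; rewrite /btw; lia.
have nz : (y - x)%:~R != 0 :> R by rewrite intr_eq0; lia.
exists ((z - x)%:~R / (y - x)%:~R); last first.
  by rewrite divfK // -rmorphD /=; congr (_%:~R); lia.
case/orP: h => h.
  have p : 0 < (y - x)%:~R :> R by rewrite ltr0z; lia.
  by rewrite divr_ge0 ?ler0z ?ler_pdivrMr ?mul1r ?ler_int //; lia.
have p : (y - x)%:~R < 0 :> R by rewrite ltrz0; lia.
by rewrite ler_ndivrMr // ler_ndivlMr // mul0r mul1r lerz0 ler_int; lia.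
Qed.

Lemma param_btw (R : realType) (x y : int) (t : R) : 0 <= t <= 1 ->
  let z := x%:~R + t * (y - x)%:~R in
  (x%:~R <= z <= y%:~R) || (y%:~R <= z <= x%:~R).
Proof.
move=> /= /andP[t0 t1]; rewrite rmorphB /=.
have [h|h] := leP (x%:~R : R) y%:~R; apply/orP; [left|right]; nra.
Qed.

(** The larger of the two lower ends lies in both intervals; the orientations of the intervals give
    four cases. *)
Lemma btw_meet (R : realType) (x y u v : int) (z : R) :
  (x%:~R <= z <= y%:~R) || (y%:~R <= z <= x%:~R) ->
  (u%:~R <= z <= v%:~R) || (v%:~R <= z <= u%:~R) ->
  exists q, btw x y q /\ btw u v q.
Proof.
have le (a b : int) : a%:~R <= z -> z <= b%:~R -> a <= b.
  by move=> az zb; rewrite -(ler_int R); apply: le_trans zb.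
rewrite /btw => /orP[]/andP[h1 h2] /orP[]/andP[h3 h4];
  have := le _ _ h1 h2; have := le _ _ h1 h4;
  have := le _ _ h3 h2; have := le _ _ h3 h4 => *.
- by exists (Num.max x u); lia.
- by exists (Num.max x v); lia.
- by exists (Num.max y u); lia.
- by exists (Num.max y v); lia.
Qed.

Definition aligned (a b : point) : bool := (a.1 == b.1) || (a.2 == b.2).

Lemma on_segment_box (R : realType) a b q : aligned a b -> box a b q ->
  on_segment a b (q.1%:~R : R, q.2%:~R).
Proof.
rewrite /aligned /box -!/(btw _ _ _) => ab /andP[h1 h2].
case/orP: ab => /eqP e.
  have [t t01 te] := btw_param R h2; exists t => //.
  rewrite te e subrr mulr0 addr0; congr (_%:~R, _).
  by move: h1; rewrite /btw e; lia.
have [t t01 te] := btw_param R h1; exists t => //.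
rewrite te e subrr mulr0 addr0; congr (_, _%:~R).
by move: h2; rewrite /btw e; lia.
Qed.

(** A box is a product of intervals, so a common integer is found on each axis separately; the
    resulting point may differ from [z]. *)
Lemma on_segment_meet (R : realType) a b c d (z : R * R) :
  on_segment a b z -> on_segment c d z -> exists q, box a b q /\ box c d q.
Proof.
case=> t /param_btw ht -> [t' /param_btw ht' [e1 e2]].
have [q1 [h1 h1']] : exists q, btw a.1 b.1 q /\ btw c.1 d.1 q.
  by apply: (btw_meet (ht a.1 b.1)); rewrite e1; apply: ht'.
have [q2 [h2 h2']] : exists q, btw a.2 b.2 q /\ btw c.2 d.2 q.
  by apply: (btw_meet (ht a.2 b.2)); rewrite e2; apply: ht'.
by exists (q1, q2); split; apply/andP.
Qed.

Lemma on_segmentC (R : realType) a b (z : R * R) :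
  on_segment a b z -> on_segment b a z.
Proof.
case=> t t01 ->; exists (1 - t); first lra.
by rewrite !rmorphB /=; congr (_, _); ring.
Qed.

Definition corner (a b c : point) : bool :=
  (a.1 == b.1) && (b.2 == c.2) || (a.2 == b.2) && (b.1 == c.1).

Lemma on_segment_corner (R : realType) a b c (z : R * R) : corner a b c ->
  on_segment a b z -> on_segment b c z -> z = (b.1%:~R, b.2%:~R).
Proof.
move=> abc [t _ ->] [u _ [e1 e2]].
by case/orP: abc => /andP[/eqP h1 /eqP h2]; congr (_, _);
  rewrite ?h1 ?e1 ?e2 ?h2 subrr mulr0 addr0.
Qed.

Lemma occ_nth l q :
  occ l q <-> exists2 j, (j.+1 < size l)%N & box l`_j l`_j.+1 q.
Proof.
elim: l => [|a [|b l] IH]; try by split=> // -[[]].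
rewrite [occ _ _]/=; split=> [/orP[h|/IH[j js h]]|[[_ h|j js h]]].
- by exists 0%N.
- by exists j.+1.
- by rewrite h.
by apply/orP; right; apply/IH; exists j.
Qed.

Lemma noncrossing_nth l : noncrossing l <->
  forall i j q, (i.+1 < j)%N -> (j.+1 < size l)%N ->
    box l`_i l`_i.+1 q -> box l`_j l`_j.+1 q -> False.
Proof.
elim: l => [|a [|b l] IH]; try by split=> // _ [|i] [|j].
rewrite [noncrossing _]/=; split=> [[h /IH cl] [|i] [|[|j]] q //|h].
- move=> _ js /h /negP + bj; apply; apply/occ_nth.
  by exists j.
- by move=> ij js; apply: (cl i j.+1).
split.
  move=> q ab; apply/negP => /occ_nth[j js].
  exact: (h 0%N j.+2).
by apply/IH => i j q ij js; apply: (h i.+1 j.+1).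
Qed.

Lemma heading_dirs w :
  heading w \in [:: (1, 0); (0, 1); (-1, 0); (0, -1)].
Proof. by elim: w => //= t w; case: t; rewrite !inE => /or4P[]/eqP->. Qed.

Lemma chain_corner w l : chain w l ->
  (forall i, (i.+1 < size l)%N -> aligned l`_i l`_i.+1) /\
  (forall i, (i.+2 < size l)%N -> corner l`_i l`_i.+1 l`_i.+2).
Proof.
elim: w l => [|t w IH] l.
  by case=> m _ ->; split=> -[|i] // _; rewrite /aligned eqxx orbT.
case=> p [l' [m [c _ ->]]]; have [al co] := IH _ c.
split=> [[_|i]|[|i]]; [|exact: al| |exact: co].
- have := heading_dirs (t :: w); move: (heading (t :: w)) => h.
  by rewrite /aligned /shift !inE => /or4P[]/eqP-> /=; lia.
case: l' c {al co} => [//|q l'] c _.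
have {c} : exists m', p = shift q (heading w) m'.
  case: w c {IH} => [|t' w].
    by case=> m' _ [-> -> _]; exists m'; rewrite /shift /= mul1r mul0r !add0r.
  by case=> p' [l'' [m' [_ _ [-> -> _]]]]; exists m'.
case=> m' ->; rewrite /corner /shift /=; have := heading_dirs w.
by case: t; rewrite !inE => /or4P[]/eqP-> /=; lia.
Qed.

Lemma simple_chainP (R : realType) w l :
  chain w l -> simple_chain R (rev l) <-> noncrossing l.
Proof.
move=> /chain_corner[al co].
(* Reversal turns segment [i] into segment [size l - i.+2], run backwards. *)
have nr i : (i.+1 < size l)%N ->
    (rev l)`_i = l`_(size l - i.+2).+1 /\ (rev l)`_i.+1 = l`_(size l - i.+2).
  move=> il; have e : (size l - i.+1 = (size l - i.+2).+1)%N by lia.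
  by rewrite !nth_rev -?e // ltnW.
rewrite noncrossing_nth; split=> [sc i j q ij js bi bj|cl i j z ij].
  have := sc (size l - j.+2)%N (size l - i.+2)%N (q.1%:~R, q.2%:~R).
  rewrite size_rev; have [] := nr (size l - j.+2)%N; first by lia.
  move=> -> ->; have [] := nr (size l - i.+2)%N; first by lia.
  move=> -> ->.
  have -> : (size l - (size l - j.+2).+2 = j)%N by lia.
  have -> : (size l - (size l - i.+2).+2 = i)%N by lia.
  case; try lia.
  - by apply/on_segmentC/on_segment_box => //; apply: al; lia.
  - by apply/on_segmentC/on_segment_box => //; apply: al; lia.
rewrite size_rev => js.
have [-> ->] := nr i (leq_ltn_trans ij (ltnW js)).
have [-> e] := nr j js; rewrite e => si sj.
case: (ltngtP j i.+1) => [ji|ji|ji]; first by lia.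
  have [q [qi qj]] := on_segment_meet si sj; exfalso.
  apply: (cl (size l - j.+2)%N (size l - i.+2)%N q); try lia.
    by rewrite boxC.
  by rewrite boxC.
split=> //; move: si sj.
have -> : (size l - i.+2 = (size l - j.+2).+1)%N by lia.
move=> si sj; apply: (on_segment_corner _ (on_segmentC sj) (on_segmentC si)).
by apply: co; lia.
Qed.

Lemma chain_size w l : chain w l -> size l = (size w).+2.
Proof.
elim: w l => [|t w IH] l; first by case=> m _ ->.
by case=> p [l' [m [/IH c _ ->]]] /=; rewrite -c.
Qed.

Lemma reachableP (R : realType) s p : reachable R s p <->
  exists l, chain (rev s) (p :: l) /\ noncrossing (p :: l).
Proof.
split=> [[ms [sz ps sc] e]|[l [c cl]]].
  have c : chain (rev s) (rev (vertices s ms)).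
    by apply/chainP; exists ms.
  move: (sc); rewrite -[vertices s ms]revK (simple_chainP _ c).
  case/lastP: (vertices s ms) c e => [|v q].
    by move/chain_size.
  by rewrite last_rcons rev_rcons => c <- cl; exists (rev v).
have [] := (chainP s (rev (p :: l))).1; first by rewrite revK.
move=> ms [sz ps e]; exists ms; last by rewrite e rev_cons last_rcons.
by split=> //; rewrite e; apply/(simple_chainP R c).
Qed.

Lemma occ_cons a b l q : occ (a :: b :: l) q = box a b q || occ (b :: l) q.
Proof. by []. Qed.

Lemma noncrossing_cons a b l : noncrossing (a :: b :: l) <->
  (forall q, box a b q -> occ l q -> False) /\ noncrossing (b :: l).
Proof.
split=> -[h cl]; split=> // q bq; first by apply/negP/h.
by apply/negP/(h q bq).
Qed.

(** * Invariants of the spiral after each full turn *)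

(* These describe a chain whose last segment goes north from (u, e) to (u, f),
   [B] being the points met before that segment.  Inward: the next segments
   stay in the box c < x < u, e < y <= f, which by the last condition either has
   no integral point on the open negative x-axis or lies left of -k. *)
Definition inward (k : int) (B : point -> bool) (u e f : int) : Prop :=
  e < f /\ exists c : int,
    [/\ c < u, B (c, f), forall x, c <= x <= u -> B (x, e)
      & [|| -1 <= c, 0 <= e, f < 0 | u <= - k]].

(* Column c is the latest southward crossing of the negative x-axis, reached
   along level t, and (u0, t) is the end of the previous northward segment. *)
Definition outward (k : int) (B : point -> bool) (u e f : int) : Prop :=
  exists c t u0 : int,
    [/\ c <= - k, e <= 0 <= t, c <= u0 < u & 0 <= u0] /\
    [/\ t < f, forall y, e <= y <= t -> B (c, y),
        forall x, c <= x <= u0 -> B (x, t)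
      & forall x, c <= x <= u -> B (x, e)].

(** Meeting every row and column replaces an intermediate value argument: any segment cutting across
    the rectangle hits [B]. *)
Definition staircase (B : point -> bool) (u f : int) : Prop :=
  [/\ 0 < u, 0 <= f,
      forall x, 0 <= x <= u -> exists2 y, 0 <= y <= f & B (x, y),
      forall y, 0 <= y <= f -> exists2 x, 0 <= x <= u & B (x, y)
    & forall x y x' y', B (x, y) -> B (x', y') -> x < x' -> y <= y'].

(** [k] counts completed turns. The staircase occurs only at the start; it includes the last north
    segment, which the other two alternatives leave out of [B]. *)
Definition state (k : int) (l : seq point) : Prop :=
  exists u e f l', [/\ l = [:: (u, f), (u, e) & l'], e < f &
    [\/ inward k (occ (behead l)) u e f, outward k (occ (behead l)) u e f
      | [/\ k = 0, 0 < f & staircase (occ l) u f]]].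

Ltac box_lia := rewrite ?occ_cons /box /=; lia.

(** The pocket has no exit: the west segment is stopped by [(c, f)], the south one by row [e], the
    east one by column [u], the north one by the new west segment. All four bounds are strict, so
    [u <= - k] improves by one and the other alternatives persist, with [w] as the new [c]. *)
Lemma inward_turn k u e f l w e2 u2 f2 :
  inward k (occ ((u, e) :: l)) u e f ->
  noncrossing [:: (u2, f2), (u2, e2), (w, e2), (w, f), (u, f), (u, e) & l] ->
  w < u -> e2 < f -> w < u2 -> e2 < f2 ->
  inward (k + 1) (occ [:: (u2, e2), (w, e2), (w, f), (u, f), (u, e) & l])
    u2 e2 f2.
Proof.
case=> ef [c [cu Bcf bot dead]].
rewrite !noncrossing_cons => -[hN [hE [hS [hW _]]]] wu e2f wu2 e2f2.
have cw : c < w by rewrite ltNge; apply/negP => wc; apply: (hW (c, f)) => //; box_lia.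
have ee2 : e < e2.
  rewrite ltNge; apply/negP => ?; apply: (hS (w, e)); first box_lia.
  by rewrite occ_cons bot ?orbT //; lia.
have u2u : u2 < u.
  by rewrite ltNge; apply/negP => ?; apply: (hE (u, e2)); box_lia.
have f2f : f2 < f.
  by rewrite ltNge; apply/negP => ?; apply: (hN (u2, f)); box_lia.
split=> //; exists w; split=> //; [box_lia|move=> x ?; box_lia|lia].
Qed.

(** The turn winds outward only if it passes column [c], row [e], column [u] and level [f] in this
    order; [w], [f], [u] then replace [c], [t], [u0]. Stopping short at any of them creates a
    pocket. *)
Lemma outward_turn k u e f l w e2 u2 f2 :
  outward k (occ ((u, e) :: l)) u e f -> e < f ->
  noncrossing [:: (u2, f2), (u2, e2), (w, e2), (w, f), (u, f), (u, e) & l] ->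
  w < u -> e2 < f -> w < u2 -> e2 < f2 ->
  let B := occ [:: (u2, e2), (w, e2), (w, f), (u, f), (u, e) & l] in
  inward (k + 1) B u2 e2 f2 \/ outward (k + 1) B u2 e2 f2.
Proof.
case=> c [t [u0 [[ck et cu0 u00] [tf left top bot]]]] ef.
rewrite !noncrossing_cons => -[hN [hE [hS _]]] wu e2f wu2 e2f2 B.
have pocket (c' : int) : c' < u2 -> B (c', f2) -> w <= c' ->
    [|| -1 <= c', 0 <= e2, f2 < 0 | u2 <= - (k + 1)] -> inward (k + 1) B u2 e2 f2.
  move=> cu2 Bc wc dead; split=> //; exists c'; split=> // x ?; rewrite /B; box_lia.
have Bw y : e2 <= y <= f -> B (w, y) by rewrite /B; box_lia.
have f2f : w <= u2 <= u -> f2 < f.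
  by move=> ?; rewrite ltNge; apply/negP => ?; apply: (hN (u2, f)); box_lia.
have u2u : e <= e2 -> u2 < u.
  by move=> ?; rewrite ltNge; apply/negP => ?; apply: (hE (u, e2)); box_lia.
have te2 : c <= w <= u0 -> t < e2.
  move=> ?; rewrite ltNge; apply/negP => ?; apply: (hS (w, t)); first box_lia.
  by rewrite occ_cons top ?orbT //; lia.
have ee2 : c <= w -> e < e2.
  move=> ?; rewrite ltNge; apply/negP => ?; apply: (hS (w, e)); first box_lia.
  by rewrite occ_cons bot ?orbT //; lia.
have u2c : w < c -> e <= e2 <= t -> u2 < c.
  move=> *; rewrite ltNge; apply/negP => ?; apply: (hE (c, e2)); first box_lia.
  by rewrite 2!occ_cons left ?orbT //; lia.
have f2e : c <= u2 <= u -> e2 < e -> f2 < e.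
  move=> *; rewrite ltNge; apply/negP => ?; apply: (hN (u2, e)); first box_lia.
  by rewrite 3!occ_cons bot ?orbT //; lia.
(* Short of column [c]: either [w <= u0] and row [t] keeps [e2] above [t >= 0], or [w > u0 >= 0]. *)
have [cw|wc] := leP c w.
  by left; apply: (pocket w) => //; [apply: Bw|]; lia.
(* Short of row [e]: either [e2 > t >= 0], or column [c] stops the east segment and
   [u2 < c <= - k]. *)
have [ee|ee] := leP e e2.
  by left; apply: (pocket w) => //; [apply: Bw|]; lia.
(* Short of column [u]: if [c <= u2], row [e] stops the north segment below the axis; otherwise
   [u2 < c <= - k]. *)
have [uu|uu] := leP u2 u.
  left; have [cu|cu] := leP c u2; by apply: (pocket w) => //; [apply: Bw|]; lia.
have [ff|ff] := leP f2 f; last first.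
  right; exists w, f, u; do 2!split; rewrite ?wu; try lia; try by [].
  - by move=> x ?; rewrite /B; box_lia.
  - by move=> x ?; rewrite /B; box_lia.
left; have [fe|fe] := ltP f2 e.
  by apply: (pocket w) => //; [apply: Bw|]; lia.
(* The north segment ends beside column [u], which becomes the left wall; there [u > u0 >= 0]. *)
by apply: (pocket u) => //; try lia; rewrite /B; box_lia.
Qed.

(** The first turn has the whole staircase as its obstacle. It encloses it and winds outward, or it
    ends in a pocket off the negative axis or left of the origin. *)
Lemma stair_turn u f l w e2 u2 f2 : 0 < f ->
  staircase (occ ((u, f) :: l)) u f ->
  noncrossing [:: (u2, f2), (u2, e2), (w, e2), (w, f), (u, f) & l] ->
  w < u -> e2 < f -> w < u2 -> e2 < f2 ->
  let B := occ [:: (u2, e2), (w, e2), (w, f), (u, f) & l] in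
  inward 1 B u2 e2 f2 \/ outward 1 B u2 e2 f2.
Proof.
move=> f0 [u0 _ colP rowP mono].
rewrite !noncrossing_cons => -[hN [hE [hS _]]] wu e2f wu2 e2f2 B.
have pocket (c' : int) : c' < u2 -> B (c', f2) -> w <= c' ->
    [|| -1 <= c', 0 <= e2, f2 < 0 | u2 <= - 1] -> inward 1 B u2 e2 f2.
  move=> cu2 Bc wc dead; split=> //; exists c'; split=> // x ?; rewrite /B; box_lia.
have Bw y : e2 <= y <= f -> B (w, y) by rewrite /B; box_lia.
have BB q : occ ((u, f) :: l) q -> B q by rewrite /B !occ_cons => ->; rewrite !orbT.
have f2f : w <= u2 <= u -> f2 < f.
  by move=> ?; rewrite ltNge; apply/negP => ?; apply: (hN (u2, f)); box_lia.
(* The staircase point in row [e2] stops the east segment; monotonicity puts it to the right of the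
   south segment. *)
have [e20|e20] := leP 0 e2.
  have [x xu Bx] := rowP e2 ltac:(lia).
  have wx : w <= x.
    have [|w0] := ltP w 0; first lia.
    have [y yf By] := colP w ltac:(lia).
    have ye : y < e2.
      rewrite ltNge; apply/negP => ?; apply: (hS (w, y)) => //; box_lia.
    rewrite leNgt; apply/negP => xw.
    by have := mono _ _ _ _ Bx By xw; lia.
  have u2x : u2 < x.
    rewrite ltNge; apply/negP => ?; apply: (hE (x, e2)); first box_lia.
    by rewrite occ_cons Bx orbT.
  by left; apply: (pocket w) => //; [apply: Bw|]; lia.
have w0 : w < 0.
  rewrite ltNge; apply/negP => w0.
  have [y yf By] := colP w ltac:(lia).
  by apply: (hS (w, y)) => //; box_lia.
have [f20|f20] := ltP f2 0.
  by left; apply: (pocket w) => //; [apply: Bw|]; lia.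
have [u20|u20] := ltP u2 0.
  by left; apply: (pocket w) => //; [apply: Bw|]; lia.
have [ff|ff] := leP f2 f; last first.
  right; exists w, f, u; do 2!split; rewrite ?wu; try lia; try by [].
  - by move=> x ?; rewrite /B; box_lia.
  - by move=> x ?; rewrite /B; box_lia.
(* The north segment ends to the right of the staircase, whose point in row [f2] is the left wall,
   with abscissa at least 0. *)
have [x xu Bx] := rowP f2 ltac:(lia).
have xu2 : x < u2.
  have [|uu] := ltP u u2; first lia.
  have [y yf By] := colP u2 ltac:(lia).
  have fy : f2 < y.
    rewrite ltNge; apply/negP => ?; apply: (hN (u2, y)); first box_lia.
    by rewrite 2!occ_cons By !orbT.
  have x_ne : x != u2.
    apply/eqP => xe; apply: (hN (u2, f2)); first box_lia.
    by rewrite 2!occ_cons; move: Bx; rewrite xe => ->; rewrite !orbT.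
  rewrite ltNge; apply/negP => u2x.
  by have := mono _ _ _ _ By Bx ltac:(lia); lia.
by left; apply: (pocket x) => //; [apply: BB|lia|lia].
Qed.

Lemma state_turn k l u e f w e2 u2 f2 :
  state k [:: (u, f), (u, e) & l] ->
  noncrossing [:: (u2, f2), (u2, e2), (w, e2), (w, f), (u, f), (u, e) & l] ->
  w < u -> e2 < f -> w < u2 -> e2 < f2 ->
  state (k + 1) [:: (u2, f2), (u2, e2), (w, e2), (w, f), (u, f), (u, e) & l].
Proof.
move=> [u' [e' [f' [l' [[<- <- _ <- _] ef st]]]]] cl *.
exists u2, e2, f2, [:: (w, e2), (w, f), (u, f), (u, e) & l]; split=> //.
case: st => [st|st|[-> f0 st]].
- by apply: Or31; apply: inward_turn.
- by case: (outward_turn st ef cl) => // ?; [apply: Or31|apply: Or32].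
by case: (stair_turn f0 st cl) => // ?; [apply: Or31|apply: Or32].
Qed.

(** Inward: [c < w < 0] and [e < 0 < f] exclude the first three alternatives, so [w < u <= - k].
    Outward: row [t] blocks the descent unless [w < c]. *)
Lemma south_bound k l u f w : 0 <= k -> state k ((u, f) :: l) ->
  noncrossing [:: (w, 0), (w, f), (u, f) & l] -> w < u -> 0 < f -> w < 0 ->
  w <= - k - 1.
Proof.
move=> k0 [u' [e [f' [l' [[<- <- ->] ef st]]]]].
rewrite !noncrossing_cons => -[hS [hW _]] wu f0 w0.
case: st => [[_ [c [cu Bcf bot dead]]]||[-> _ _]]; last lia.
  have cw : c < w.
    by rewrite ltNge; apply/negP => wc; apply: (hW (c, f)) => //; box_lia.
  have ee2 : e < 0.
    rewrite ltNge; apply/negP => ?; apply: (hS (w, e)); first box_lia.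
    by rewrite occ_cons bot ?orbT //; lia.
  lia.
case=> c [t [u0 [[ck et cu0 u00] [tf left top bot]]]].
have [|cw] := ltP w c; first lia.
exfalso; apply: (hS (w, t)); first box_lia.
by rewrite occ_cons top ?orbT //; lia.
Qed.

(** As in [south_bound], but the east segment must also stop before column [u] (inward) or before
    column [c] (outward). *)
Lemma east_bound k l u f w x : 0 <= k -> state k ((u, f) :: l) ->
  noncrossing [:: (x, 0), (w, 0), (w, f), (u, f) & l] ->
  w < u -> 0 < f -> w < x -> x < 0 -> x <= - k - 1.
Proof.
move=> k0 st cl wu f0 wx x0.
have := south_bound k0 st (proj2 cl) wu f0 (lt_trans wx x0).
case: st cl => [u' [e [f' [l' [[<- <- ->] ef st]]]]].
rewrite !noncrossing_cons => -[hE [hS [hW _]]] wk.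
case: st => [[_ [c [cu Bcf bot dead]]]||[-> _ _]]; last lia.
  have ee2 : e < 0.
    have cw : c < w.
      by rewrite ltNge; apply/negP => wc; apply: (hW (c, f)) => //; box_lia.
    rewrite ltNge; apply/negP => ?; apply: (hS (w, e)); first box_lia.
    by rewrite occ_cons bot ?orbT //; lia.
  have xu : x < u.
    by rewrite ltNge; apply/negP => ?; apply: (hE (u, 0)); box_lia.
  have cw : c < w.
    by rewrite ltNge; apply/negP => wc; apply: (hW (c, f)) => //; box_lia.
  lia.
case=> c [t [u0 [[ck et cu0 u00] [tf left top bot]]]].
have [wc|cw] := ltP w c; last first.
  exfalso; apply: (hS (w, t)); first box_lia.
  by rewrite occ_cons top ?orbT //; lia.
have [|cx] := ltP x c; first lia.
exfalso; apply: (hE (c, 0)); first box_lia.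
by rewrite 2!occ_cons left ?orbT //; lia.
Qed.

Lemma north_bound k l u : state k ((u, 0) :: l) -> u < 0 -> u <= - k.
Proof.
move=> [u' [e [f' [l' [[<- <- _] ef st]]]]] uneg.
case: st => [[_ [c [cu _ _ dead]]]||[-> //]]; first lia.
case=> c [t [u0 [[ck et cu0 u00] _]]]. lia.
Qed.

(** * Last segments in coordinates *)

Lemma chain_cons t w l : chain (t :: w) l <->
  exists x y l' m, [/\ chain w ((x, y) :: l'), 0 < m
    & l = [:: (x + (heading (t :: w)).1 * m, y + (heading (t :: w)).2 * m),
              (x, y) & l']].
Proof.
by split=> [[[x y]]|[x [y]]] h; [exists x, y|exists (x, y)].
Qed.

Lemma chain_east t w l : heading (t :: w) = (1, 0) ->
  chain (t :: w) l <-> exists x y l' x',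
    [/\ chain w ((x, y) :: l'), x < x' & l = [:: (x', y), (x, y) & l']].
Proof.
move=> h; rewrite chain_cons h; split=> -[x [y [l' [m [c m0 ->]]]]].
  by exists x, y, l', (x + m); rewrite /= mul1r mul0r addr0; split=> //; lia.
exists x, y, l', (m - x); rewrite /= mul1r mul0r addr0 subrKC.
by split=> //; lia.
Qed.

Lemma chain_west t w l : heading (t :: w) = (-1, 0) ->
  chain (t :: w) l <-> exists x y l' x',
    [/\ chain w ((x, y) :: l'), x' < x & l = [:: (x', y), (x, y) & l']].
Proof.
move=> h; rewrite chain_cons h; split=> -[x [y [l' [m [c m0 ->]]]]].
  by exists x, y, l', (x - m); rewrite /= mulN1r mul0r addr0; split=> //; lia.
exists x, y, l', (x - m); rewrite /= mulN1r mul0r addr0 opprB subrKC.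
by split=> //; lia.
Qed.

Lemma chain_north t w l : heading (t :: w) = (0, 1) ->
  chain (t :: w) l <-> exists x y l' y',
    [/\ chain w ((x, y) :: l'), y < y' & l = [:: (x, y'), (x, y) & l']].
Proof.
move=> h; rewrite chain_cons h; split=> -[x [y [l' [m [c m0 ->]]]]].
  by exists x, y, l', (y + m); rewrite /= mul1r mul0r addr0; split=> //; lia.
exists x, y, l', (m - y); rewrite /= mul1r mul0r addr0 subrKC.
by split=> //; lia.
Qed.

Lemma chain_south t w l : heading (t :: w) = (0, -1) ->
  chain (t :: w) l <-> exists x y l' y',
    [/\ chain w ((x, y) :: l'), y' < y & l = [:: (x, y'), (x, y) & l']].
Proof.
move=> h; rewrite chain_cons h; split=> -[x [y [l' [m [c m0 ->]]]]].
  by exists x, y, l', (y - m); rewrite /= mulN1r mul0r addr0; split=> //; lia.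
exists x, y, l', (y - m); rewrite /= mulN1r mul0r addr0 opprB subrKC.
by split=> //; lia.
Qed.

(** * Staircases and spirals *)

Definition stairs (j : nat) : seq turn := iter j (cat [:: TurnR; TurnL]) [::].

(* Reversal of (LR)^j L^(4k+1). *)
Definition spiral (k j : nat) : seq turn :=
  iter k (cat (nseq 4 TurnL)) (TurnL :: stairs j).

Lemma heading_stairs j : heading (stairs j) = (1, 0).
Proof. by elim: j => //= j ->. Qed.

Lemma heading_spiral k j : heading (spiral k j) = (0, 1).
Proof. by elim: k => [|k /= ->] //=; rewrite heading_stairs. Qed.

(* [l] is a monotone path from the origin to (u, f) meeting every intermediate
   row and column. *)
Definition monotone (l : seq point) (u f : int) : Prop :=
  [/\ forall x y, occ l (x, y) -> 0 <= x <= u /\ 0 <= y <= f,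
      forall x, 0 <= x <= u -> exists y, occ l (x, y),
      forall y, 0 <= y <= f -> exists x, occ l (x, y)
    & forall x y x' y', occ l (x, y) -> occ l (x', y') -> x < x' -> y <= y'].

Lemma monotone_cons l u f u' f' : monotone ((u, f) :: l) u f ->
  0 <= u <= u' -> 0 <= f <= f' -> u' = u \/ f' = f ->
  monotone [:: (u', f'), (u, f) & l] u' f'.
Proof.
move=> [bnd col row mono] uu ff al; split=> [x y|x xu|y yf|x y x' y'].
- by rewrite occ_cons => /orP[|/bnd]; [rewrite /box /=|]; lia.
- have [xu'|xu'] := leP x u.
    have [|y By] := col x; first lia.
    by exists y; rewrite occ_cons By orbT.
  by exists f; box_lia.
- have [yf'|yf'] := leP y f.
    have [|x Bx] := row y; first lia.
    by exists x; rewrite occ_cons Bx orbT.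
  by exists u; box_lia.
rewrite !occ_cons => /orP[b|B] /orP[b'|B'].
- by move: b b'; rewrite /box /=; lia.
- by have := bnd _ _ B'; move: b; rewrite /box /=; lia.
- by have := bnd _ _ B; move: b'; rewrite /box /=; lia.
exact: mono.
Qed.

Lemma chain_stairs j l : chain (stairs j) l ->
  exists u f l', [/\ l = (u, f) :: l', 0 < u, 0 <= f & monotone l u f].
Proof.
elim: j l => [|j IH] l.
  case=> m m0 ->; exists m, 0, [:: (0, 0)]; split=> //; split=> [x y|x ?|y ?|x y x' y'].
  - by rewrite occ_cons /box /=; lia.
  - by exists 0; box_lia.
  - by exists 0; box_lia.
  - by rewrite !occ_cons /box /=; lia.
rewrite /stairs iterS -/(stairs j) /=.
move/(chain_east _ (heading_stairs j.+1)) => [x [y [l1 [x' [c xx ->]]]]].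
have hN : heading (TurnL :: stairs j) = (0, 1) by rewrite /= heading_stairs.
have /(chain_north _ hN) [x1 [y1 [l2 [y2 [c' yy [ex ey el]]]]]] := c.
have [u [f [l3 [[eu ef e3] u0 f0 m]]]] := IH _ c'; subst.
exists x', y2, [:: (u, y2), (u, f) & l3]; split=> //; try lia.
by do 2!(apply: monotone_cons; try lia).
Qed.

Lemma chainL w l : heading w = (0, 1) -> chain (TurnL :: w) l ->
  exists u f l' x, [/\ chain w ((u, f) :: l'), x < u
                      & l = [:: (x, f), (u, f) & l']].
Proof.
by move=> h; rewrite chain_west //= h.
Qed.

Lemma chainLL w l : heading w = (0, 1) -> chain [:: TurnL, TurnL & w] l ->
  exists u f l' x y, [/\ chain w ((u, f) :: l'), x < u, y < f
                        & l = [:: (x, y), (x, f), (u, f) & l']].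
Proof.
move=> h; rewrite chain_south ?[heading _]/= ?h // => -[? [? [? [y [c yf ->]]]]].
have [u [f [l' [x [c' xu [ex ey el]]]]]] := chainL h c; subst.
by exists u, f, l', x, y.
Qed.

Lemma chainLLL w l : heading w = (0, 1) ->
  chain [:: TurnL, TurnL, TurnL & w] l ->
  exists u f l' x y x2,
    [/\ chain w ((u, f) :: l'), [/\ x < u, y < f & x < x2]
      & l = [:: (x2, y), (x, y), (x, f), (u, f) & l']].
Proof.
move=> h; rewrite chain_east ?[heading _]/= ?h // => -[? [? [? [x2 [c xx ->]]]]].
have [u [f [l' [x [y [c' xu yf [ex ey el]]]]]]] := chainLL h c; subst.
by exists u, f, l', x, y, x2.
Qed.

Lemma chainLLLL w l : heading w = (0, 1) ->
  chain [:: TurnL, TurnL, TurnL, TurnL & w] l ->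
  exists u f l' x y x2 y2,
    [/\ chain w ((u, f) :: l'), [/\ x < u, y < f, x < x2 & y < y2]
      & l = [:: (x2, y2), (x2, y), (x, y), (x, f), (u, f) & l']].
Proof.
move=> h; rewrite chain_north ?[heading _]/= ?h // => -[? [? [? [y2 [c yy ->]]]]].
have [u [f [l' [x [y [x2 [c' [xu yf xx] [ex ey el]]]]]]]] := chainLLL h c; subst.
by exists u, f, l', x, y, x2, y2.
Qed.

Lemma chain_spiral0 j l : chain (spiral 0 j) l ->
  exists u f e l', [/\ l = [:: (u, f), (u, e) & l'], e < f, 0 < f
                      & staircase (occ l) u f].
Proof.
have hN : heading (TurnL :: stairs j) = (0, 1) by rewrite /= heading_stairs.
move/(chain_north _ hN) => [x [y [l' [y' [c yy ->]]]]].
have [u [f [l1 [[eu ef e1] u0 f0 m]]]] := chain_stairs c; subst.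
have [|||bnd col row mono] := monotone_cons (u' := u) (f' := y') m; try lia.
exists u, y', f, l1; split=> //; first lia.
split=> //; first lia.
  by move=> x /col[y By]; exists y => //; have := bnd _ _ By; lia.
by move=> y /row[x Bx]; exists x => //; have := bnd _ _ Bx; lia.
Qed.

Lemma chain_spiral k j l : chain (spiral k j) l -> noncrossing l -> state k%:Z l.
Proof.
elim: k l => [|k IH] l.
  move=> /chain_spiral0[u [f [e [l' [-> ef f0 st]]]]] _.
  by exists u, e, f, l'; split=> //; apply: Or33.
case/(chainLLLL (heading_spiral k j)) => u [f [l' [x [y [x2 [y2 [c h ->]]]]]]] cl.
have := cl; rewrite 4!noncrossing_cons => -[_ [_ [_ [_ /(IH _ c) st]]]].
case: (st) h => [u' [e [f' [l1 [[eu ef el] _ _]]]]] [? ? ? ?]; subst.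
by rewrite -addn1 PoszD; apply: state_turn.
Qed.

(** * Lower bounds for the explicit words *)

Definition bounded (w : seq turn) (b : int) : Prop :=
  forall l a, chain w ((a, 0) :: l) -> noncrossing ((a, 0) :: l) -> a < 0 ->
    a <= - b.

Lemma chain_origin w l : chain w l -> occ l (0, 0).
Proof.
elim: w l => [|t w IH] l; first by case=> m m0 ->; rewrite occ_cons /box /=; lia.
by case=> p [l' [m [/IH c _ ->]]]; rewrite occ_cons c orbT.
Qed.

(** If the last west segment starts on the negative axis, it adds at least one to the earlier bound.
    Otherwise it passes through the origin, which lies on an earlier, non-adjacent segment. *)
Lemma bounded_west t t' w b : heading [:: t, t' & w] = (-1, 0) ->
  bounded (t' :: w) b -> bounded [:: t, t' & w] (b + 1).
Proof.
move=> h bw l a /(chain_west _ h) [u [y [l' [x [c xu [ea ey el]]]]]]; subst.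
move=> cl a0; have [u0|u0] := ltP u 0.
  by have := bw _ _ c (proj2 cl) u0; lia.
have {c} : occ l' (0, 0).
  by case: c => p [l'' [m [/chain_origin c _ [_ _ ->]]]].
move=> o; case: l' o cl => [//|p l'] o; rewrite noncrossing_cons => -[h0 _].
by case: (h0 (0, 0)) => //; box_lia.
Qed.

Lemma bounded_spiral k j : bounded (spiral k j) k%:Z.
Proof. by move=> l a c cl; apply: north_bound; apply: chain_spiral c cl. Qed.

Lemma bounded_spiralL k j : bounded (TurnL :: spiral k j) (k%:Z + 1).
Proof.
have := @bounded_spiral k j; have := heading_spiral k j.
have [t [w ->]] : exists t w, spiral k j = t :: w.
  by case: k => [|k]; [exists TurnL, (stairs j)|eexists; eexists].
by move=> h; apply: bounded_west; rewrite /= in h *; rewrite h.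
Qed.

Lemma bounded_spiralLL k j : bounded [:: TurnL, TurnL & spiral k j] (k%:Z + 1).
Proof.
move=> l a /(chainLL (heading_spiral k j)).
move=> [u [f [l' [x [y [c xu yf [ea ey ->]]]]]]]; subst => cl a0.
rewrite opprD; apply: (south_bound _ _ cl) => //.
by apply: chain_spiral c (proj2 (proj2 cl)).
Qed.

Lemma bounded_spiralLLL k j :
  bounded [:: TurnL, TurnL, TurnL & spiral k j] (k%:Z + 1).
Proof.
move=> l a /(chainLLL (heading_spiral k j)).
move=> [u [f [l' [x [y [x2 [c [xu yf xx] [ea ey ->]]]]]]]]; subst => cl a0.
rewrite opprD; apply: (east_bound _ _ cl) => //.
by apply: chain_spiral c (proj2 (proj2 (proj2 cl))).
Qed.

Lemma bounded_spiralLLR k j :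
  bounded [:: TurnR, TurnL, TurnL & spiral k j] (k%:Z + 2).
Proof.
have -> : k%:Z + 2 = k%:Z + 1 + 1 by lia.
by apply: bounded_west (@bounded_spiralLL k j); rewrite /= heading_spiral.
Qed.

(** A south segment in a column between 0 and [u] would hit the staircase on its way down to the
    axis. *)
Lemma spiral0_west j x y u f l : chain (spiral 0 j) ((u, f) :: l) ->
  noncrossing [:: (x, y), (x, f), (u, f) & l] -> x < u -> y <= 0 -> x < 0 < f.
Proof.
case/chain_spiral0 => u' [f' [e [l' [[<- <- ->] _ f0 [_ _ col _ _]]]]].
rewrite noncrossing_cons => -[hS _] xu y0; rewrite f0 andbT ltNge; apply/negP => x0.
have [y' yf By] := col x ltac:(lia).
by apply: (hS (x, y')) => //; box_lia.
Qed.

Lemma chain_spiral0LLRR j l :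
  chain [:: TurnR, TurnR, TurnL, TurnL & spiral 0 j] l ->
  exists u f l' x y x2 y2,
    [/\ chain (spiral 0 j) ((u, f) :: l'), [/\ x < u, y < f, x2 < x & y < y2]
      & l = [:: (x2, y2), (x2, y), (x, y), (x, f), (u, f) & l']].
Proof.
have h := heading_spiral 0 j.
rewrite chain_north; last by rewrite /= heading_stairs.
move=> [? [? [? [y2 [+ yy ->]]]]].
rewrite chain_west; last by rewrite /= heading_stairs.
move=> [? [? [? [x2 [+ xx [-> ey ->]]]]]]; subst.
case/(chainLL h) => [u [f [l' [x [y [c' xu yf [ex ey el]]]]]]]; subst.
by exists u, f, l', x, y, x2, y2.
Qed.

(** The south segment lies in a column at most -1, and the next segment moves further west. *)
Lemma bounded_spiral0LLRR j :
  bounded [:: TurnR, TurnR, TurnL, TurnL & spiral 0 j] 2.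
Proof.
move=> l a /chain_spiral0LLRR.
move=> [u [f [l' [x [y [x2 [y2 [c [xu yf xx yy] [ea ey ->]]]]]]]]]; subst.
by case=> _ [_ cl] a0; have := spiral0_west c cl xu (ltW yy); lia.
Qed.

Lemma bounded_spiral0LLRRL j :
  bounded [:: TurnL, TurnR, TurnR, TurnL, TurnL & spiral 0 j] 3.
Proof.
apply: (bounded_west (b := 2)) (@bounded_spiral0LLRR j).
by rewrite /= heading_stairs.
Qed.

Lemma bounded_spiral0LLRRR j :
  bounded [:: TurnR, TurnR, TurnR, TurnL, TurnL & spiral 0 j] 2.
Proof.
move=> l a; rewrite chain_east; last first.
  by rewrite /= heading_stairs.
move=> [? [? [? [x3 [/chain_spiral0LLRR + xx3 [-> ey ->]]]]]].
move=> [u [f [l' [x [y [x2 [y2 [c [xu yf xx yy] [ea eb ec]]]]]]]]]; subst.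
move=> cl a0; have [_ [_ [_ clw]]] := cl.
have /andP[x0 f0] := spiral0_west c clw xu (ltW yy).
(* The final east segment is caught behind the south segment in column [x <= -1]. *)
have [|xx'] := ltP x3 x; first lia.
by move: cl; rewrite noncrossing_cons => -[hE _]; case: (hE (x, 0)); box_lia.
Qed.

(** * Realizability of the explicit words *)

Definition dot (h q : point) : int := h.1 * q.1 + h.2 * q.2.

(** A half-plane with axis-parallel boundary contains the box of any two of its points. *)
Lemma occ_dot h c l q : h \in [:: (1, 0); (0, 1); (-1, 0); (0, -1)] ->
  all (fun p => dot h p <= c) l -> occ l q -> dot h q <= c.
Proof.
move=> hh; elim: l => [//|a [//|b l] IH] al; rewrite occ_cons => /orP[|]; last first.
  by apply: IH; case/andP: al.
case/and3P: al => ha hb _; move: ha hb; rewrite /box /dot.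
by move: hh; rewrite !inE => /or4P[]/eqP-> /=; lia.
Qed.

Lemma dot_ubound h l : exists M : int, all (fun p => dot h p < M) l.
Proof.
elim: l => [|a l [M hM]]; first by exists 0.
exists (Num.max M (dot h a + 1)); rewrite /= lt_max; apply/andP; split; first lia.
by apply: sub_all hM => p; rewrite lt_max => ->.
Qed.

(* Each segment may be made so long that its endpoint lies strictly ahead of
   everything before it; the next segment is then perpendicular to the heading
   and touches nothing but that endpoint. *)
Lemma chain_exists w : exists p l, [/\ chain w (p :: l), noncrossing (p :: l)
  & all (fun q => dot (heading w) q < dot (heading w) p) l].
Proof.
elim: w => [|t w [p [l [c cl ahead]]]].
  by exists (1, 0), [:: (0, 0)]; split=> //; exists 1.
set h' := heading (t :: w); have [M /= /andP[pM lM]] := dot_ubound h' (p :: l).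
exists (shift p h' (M - dot h' p)), (p :: l); split.
- by exists p, l, (M - dot h' p); rewrite subr_gt0.
- case: l c cl ahead lM => [|a l] c cl ahead lM; first by split=> // q _.
  apply/noncrossing_cons; split=> // q bq oq.
  (* The new segment is perpendicular to [heading w], so all its points are level with [p], strictly
     ahead of [q]. *)
  have : dot (heading w) q <= dot (heading w) p - 1.
    apply: occ_dot oq; first exact: heading_dirs.
    by apply: sub_all ahead => r /=; lia.
  have := heading_dirs w; move: bq; rewrite /h' /box /shift /dot /=.
  by case: t @h' pM lM => _ _ _; rewrite !inE /= => bq /or4P[]/eqP e;
    move: bq; rewrite e /=; lia.
have -> : dot h' (shift p h' (M - dot h' p)) = M.
  have := heading_dirs (t :: w); rewrite -/h' /shift /dot !inE.
  by case/or4P => /eqP-> /=; lia.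
by rewrite /= pM.
Qed.

Lemma spiral_exists k j : exists u f l (M : int),
  [/\ chain (spiral k j) ((u, f) :: l), noncrossing ((u, f) :: l), 0 < f,
      forall q, occ ((u, f) :: l) q -> M <= q.1 & forall q, occ l q -> q.2 < f].
Proof.
have [[u f] [l [c cl]]] := chain_exists (spiral k j).
rewrite heading_spiral => top.
have below q : occ l q -> q.2 < f.
  move=> o; have : dot (0, 1) q <= f - 1; last by rewrite /dot /=; lia.
  by apply: occ_dot o => //; apply: sub_all top => p; rewrite /dot /=; lia.
have [M hM] := dot_ubound (-1, 0) ((u, f) :: l).
exists u, f, l, (- M); split=> //.
  apply: (below (0, 0)).
  have [t [w e]] : exists t w, spiral k j = t :: w.
    by case: (k) => [|k']; eexists; eexists.
  move: c; rewrite e => -[p [l' [m [/chain_origin + _ [_ _ ->]]]]].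
  by [].
move=> q o; have : dot (-1, 0) q <= M; last by rewrite /dot /=; lia.
by apply: occ_dot o => //; apply: sub_all hM => p /ltW.
Qed.

Lemma chain_go m t w x y x' y' l : chain w ((x, y) :: l) -> 0 < m ->
  x' = x + (heading (t :: w)).1 * m -> y' = y + (heading (t :: w)).2 * m ->
  chain (t :: w) [:: (x', y'), (x, y) & l].
Proof. by move=> c m0 -> ->; exists (x, y), l, m. Qed.

Definition reaching (w : seq turn) : Prop :=
  exists a l, [/\ a < 0, chain w ((a, 0) :: l) & noncrossing ((a, 0) :: l)].

Ltac go n := apply: (chain_go (m := n)); try (rewrite /= ?heading_spiral /=; lia).

(** Peels off the hand-placed segments one at a time: they avoid the spiral because it stays to the
    right of them. *)
Ltac tidy left cl :=
  first [exact: cl | apply/noncrossing_cons; split; [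
    let x := fresh in let y := fresh in
    move=> [x y] +; rewrite ?occ_cons; have := left (x, y);
    rewrite /box /=; lia | tidy left cl]].

(** The first five endings serve the residues 3, 0, 1, 2 (ending in L) and 2 (ending in R) of
    [l - r]; the last three serve [l - r] equal to 1, 0 and 2 (ending in L). *)
Definition tails : seq (seq turn) :=
  [:: [::]; [:: TurnL]; nseq 2 TurnL; nseq 3 TurnL; [:: TurnR];
      nseq 2 TurnR; nseq 3 TurnR; [:: TurnL; TurnR; TurnR]].

Lemma reaching_spiral k j t : t \in tails ->
  reaching (t ++ [:: TurnL, TurnL & spiral k j]).
Proof.
have [u [f [l [M [c cl f0 left below]]]]] := spiral_exists k j.
have M0 : M <= 0 by apply: (left (0, 0)); apply: chain_origin c.
have hu : M <= u.
  case: l c left {cl below} => [/chain_size //|p l] _ left.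
  by apply: (left (u, f)); box_lia.
(* The endings move at most 2 east of [w], hence stay left of [M], and [M <= 0] keeps their
   endpoints on the negative side. *)
pose w := M - 3.
have clW : noncrossing [:: (w, f), (u, f) & l].
  apply/noncrossing_cons; split=> // -[qx qy] bq /below; move: bq.
  by rewrite /box /=; lia.
have chS y : y <= 0 ->
    chain [:: TurnL, TurnL & spiral k j] [:: (w, y), (w, f), (u, f) & l].
  move=> y0; go (f - y). by go (u - w).
have clS y : noncrossing [:: (w, y), (w, f), (u, f) & l].
  apply/noncrossing_cons; split=> // -[qx qy] bq /left; move: bq.
  by rewrite /box /=; lia.
rewrite !inE => /or4P[/eqP->|/eqP->|/eqP->|/or4P[/eqP->|/eqP->|/eqP->|/orP[]/eqP->]].
- exists w, [:: (w, f), (u, f) & l]; split; [lia|exact: chS|exact: clS].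
- exists (w + 2), [:: (w, 0), (w, f), (u, f) & l]; split; first lia.
    by go (2 : int); apply: chS.
  by tidy left (clS 0).
- exists (w + 2), [:: (w + 2, -1), (w, -1), (w, f), (u, f) & l]; split; first lia.
    by go (1 : int); go (2 : int); apply: chS.
  by tidy left (clS (-1)).
- exists (w + 1), [:: (w + 2, 0), (w + 2, -1), (w, -1), (w, f), (u, f) & l].
  split; first lia.
    by go (1 : int); go (1 : int); go (2 : int); apply: chS.
  by tidy left (clS (-1)).
- exists (w - 1), [:: (w, 0), (w, f), (u, f) & l]; split; first lia.
    by go (1 : int); apply: chS.
  by tidy left (clS 0).
- exists (w - 2), [:: (w - 2, -1), (w, -1), (w, f), (u, f) & l]; split; first lia.
    by go (1 : int); go (2 : int); apply: chS.
  by tidy left (clS (-1)).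
- exists (w - 1), [:: (w - 2, 0), (w - 2, -1), (w, -1), (w, f), (u, f) & l].
  split; first lia.
    by go (1 : int); go (1 : int); go (2 : int); apply: chS.
  by tidy left (clS (-1)).
exists (w - 3), [:: (w - 2, 0), (w - 2, -1), (w, -1), (w, f), (u, f) & l].
split; first lia.
  by go (1 : int); go (1 : int); go (2 : int); apply: chS.
by tidy left (clS (-1)).
Qed.

(** * From one word to the maximum *)

Lemma count_stairs j :
  count_mem TurnL (stairs j) = j /\ count_mem TurnR (stairs j) = j.
Proof. by elim: j => //= j [-> ->]. Qed.

Lemma count_spiral k j : count_mem TurnL (spiral k j) = (4 * k + j + 1)%N /\
  count_mem TurnR (spiral k j) = j.
Proof.
elim: k => [|k [IHl IHr]]; first by have [/= -> ->] := count_stairs j; lia.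
by rewrite /= IHl IHr; lia.
Qed.

Lemma size_count w : size w = (count_mem TurnL w + count_mem TurnR w)%N.
Proof. by elim: w => //= t w ->; case: t => /=; lia. Qed.

Lemma reachingP (R : realType) s : reaches_negx R s <-> reaching (rev s).
Proof.
split=> [[a a0 /reachableP[l [c cl]]]|[a [l [a0 c cl]]]]; first by exists a, l.
by exists a => //; apply/reachableP; exists l.
Qed.

(** The closest point is itself reachable by [xnegP], so [bounded] applies to it, and the maximum
    dominates this one word. *)
Lemma le_xneg_max (R : realType) w b l r :
  count_mem TurnL w = l -> count_mem TurnR w = r ->
  reaching w -> bounded w b -> b <= (xneg_max R l r)%:Z.
Proof.
move=> hl hr; rewrite -[w]revK => /(reachingP R) h bw.
have sz : size (rev w) == (l + r)%N by rewrite size_rev size_count hl hr.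
have [x0 /reachableP[p [c cl]] _] := xnegP h.
have hb := bw _ _ c cl x0.
have : (`|xneg R (Tuple sz)| <= xneg_max R l r)%N.
  apply: leq_bigmax_cond; rewrite /= !count_rev hl hr !eqxx /=.
  exact/asboolP.
by move: x0 hb => /=; lia.
Qed.

(** * Too few right turns *)

(** For an explicit word, a chain becomes linear equations between coordinates and segment
    lengths. *)
Ltac unchain :=
  repeat match goal with
  | H : chain (_ :: _) _ |- _ => let x := fresh "x" in let y := fresh "y" in
     let l := fresh "l" in let m := fresh "m" in let p := fresh "p" in
     let e := fresh "e" in
     case/chain_cons: H => [x [y [l [m [H p e]]]]];
     cbn [heading turn_dir fst snd] in e; injection e => {e} *
  | H : chain nil _ |- _ => let m := fresh "m" in let p := fresh "p" in
     let e := fresh "e" in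
     case: H => m p e; injection e => {e} *
  end.

(** At most two right turns leave finitely many words, and each has contradictory coordinate
    equations. *)
Lemma reaching_eq w : reaching w -> count_mem TurnL w = count_mem TurnR w ->
  (2 < count_mem TurnR w)%N.
Proof.
move=> hw e; rewrite ltnNge; apply/negP => r2; have := size_count w.
case: w e r2 hw => [|[] [|[] [|[] [|[] [|t w]]]]] //= e r2 hw sz; try lia.
all: by case: hw => a [l [a0 c _]]; unchain; lia.
Qed.

Lemma reaching_succ w : reaching w ->
  count_mem TurnL w = (count_mem TurnR w + 1)%N -> (1 < count_mem TurnR w)%N.
Proof.
move=> hw e; rewrite ltnNge; apply/negP => r2; have := size_count w.
case: w e r2 hw => [|[] [|[] [|[] [|t w]]]] //= e r2 hw sz; try lia.
all: by case: hw => a [l [a0 c _]]; unchain; lia.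
Qed.

Lemma reaching_succ2 w : reaching w ->
  count_mem TurnL w = (count_mem TurnR w + 2)%N -> head TurnR w = TurnL ->
  (1 < count_mem TurnR w)%N.
Proof.
move=> hw e hd; rewrite ltnNge; apply/negP => r2; have := size_count w.
case: w e r2 hd hw => [|[] [|[] [|[] [|[] [|t w]]]]] //= e r2 hd hw sz; try lia.
all: case: hw => a [l [a0 c cl]]; try by unchain; lia.
(* Only the word RLLL is left. RLL never ends on the negative axis, so any bound holds for it; with
   [- a], [bounded_west] yields [a <= a - 1]. *)
suff bw : bounded [:: TurnL; TurnL; TurnR] (- a).
  by have := @bounded_west TurnL TurnL [:: TurnL; TurnR] _ erefl bw _ _ c cl a0; lia.
by move=> l' u c' _ u0; unchain; lia.
Qed.

Lemma le_xneg_max_spiral (R : realType) t k j b l r : t \in tails ->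
  (count_mem TurnL t + (4 * k + j + 3))%N = l -> (count_mem TurnR t + j)%N = r ->
  bounded (t ++ [:: TurnL, TurnL & spiral k j]) b -> b <= (xneg_max R l r)%:Z.
Proof.
move=> ht <- <-; have [cl cr] := count_spiral k j.
apply: le_xneg_max; last exact: reaching_spiral.
  by rewrite count_cat; congr addn; rewrite /= cl; lia.
by rewrite count_cat; congr addn; rewrite /= cr; lia.
Qed.

Theorem theorem27 (R : realType) (l r : nat) (s : seq turn)
    (hl : count_mem TurnL s = l) (hr : count_mem TurnR s = r)
    (hlr : 0 <= l%:Z - r%:Z) (hs : reaches_negx R s) :
  let d : int := l%:Z - r%:Z in
  let k : int := ((d + 2) %/ 4)%Z in
  let x : int := (xneg_max R l r)%:Z in
  [/\ (d = 0 %[mod 4])%Z \/ (d = 1 %[mod 4])%Z -> `|k - 1| + 1 <= x,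
      (d = 2 %[mod 4])%Z ->
        (last TurnR s = TurnL -> `|k - 2| + 2 <= x) /\
        (last TurnL s = TurnR -> k + 1 <= x)
    & (d = 3 %[mod 4])%Z -> k <= x].
Proof.
move=> d k x.
have hw : reaching (rev s) by apply/(reachingP R).
have head_last t : head t (rev s) = last t s.
  by case/lastP: (s) => // s' t'; rewrite rev_rcons last_rcons.
have r_eq : l = r -> (2 < r)%N.
  by rewrite -hl -hr -!(count_rev _ s); apply: reaching_eq.
have r_succ : l = (r + 1)%N -> (1 < r)%N.
  by rewrite -hl -hr -!(count_rev _ s); apply: reaching_succ.
have r_succ2 : last TurnR s = TurnL -> l = (r + 2)%N -> (1 < r)%N.
  by rewrite -hl -hr -!(count_rev _ s) -head_last => *; apply: reaching_succ2.
(* The default [TurnL] makes an empty [s] violate the premise. *)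
have r_pos : last TurnL s = TurnR -> (0 < r)%N.
  by rewrite -hr; case/lastP: (s) => // s' t'; rewrite last_rcons => ->;
    rewrite -cats1 count_cat addn1.
have [q] : exists q : nat, 0 <= d - 4 * q%:Z < 4.
  by exists ((l - r) %/ 4)%N; rewrite /d; lia.
have ed : d = l%:Z - r%:Z by [].
have ek : k = ((d + 2) %/ 4)%Z by [].
move: d k ed ek {hlr hl hr hs hw} => d k ed ek dq.
have wit t i j b := @le_xneg_max_spiral R t i j b l r.
rewrite -/x in wit; move: x wit => x wit.
split=> [hd|hd|hd].
- have {}hd : d = 4 * q%:Z \/ d = 4 * q%:Z + 1 by lia.
  have {ek} -> : k = q%:Z by lia.
  (* For [q = 0] the required value is 2; it comes from the endings that spend right turns, hence
     the lower bounds on [r]. *)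
  case: q {dq} hd => [|q] [hd|hd].
  + have r3 := r_eq ltac:(lia).
    have := wit (nseq 3 TurnR) 0%N (r - 3)%N _ isT _ _ (@bounded_spiral0LLRRR _).
    by move=> /=; lia.
  + have r2 := r_succ ltac:(lia).
    have := wit (nseq 2 TurnR) 0%N (r - 2)%N _ isT _ _ (@bounded_spiral0LLRR _).
    by move=> /=; lia.
  + have := wit [:: TurnL] q r _ isT _ _ (@bounded_spiralLLL _ _).
    by move=> /=; lia.
  (* With these two turns the word is exactly [spiral q.+1 r]. *)
  have := wit [:: TurnL; TurnL] q r _ isT _ _ (@bounded_spiral q.+1 _).
  by move=> /=; lia.
- have {}hd : d = 4 * q%:Z + 2 by lia.
  have {ek} -> : k = q%:Z + 1 by lia.
  split=> [sL|sR].
    case: q {dq} hd => [|q] hd.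
      have r2 := r_succ2 sL ltac:(lia).
      have := wit [:: TurnL; TurnR; TurnR] 0%N (r - 2)%N _ isT _ _
        (@bounded_spiral0LLRRL _).
      by move=> /=; lia.
    have := wit (nseq 3 TurnL) q r _ isT _ _ (@bounded_spiralL q.+1 _).
    by move=> /=; lia.
  have r0 := r_pos sR.
  have := wit [:: TurnR] q (r - 1)%N _ isT _ _ (@bounded_spiralLLR _ _).
  by move=> /=; lia.
have {}hd : d = 4 * q%:Z + 3 by lia.
have {ek} -> : k = q%:Z + 1 by lia.
have := wit [::] q r _ isT _ _ (@bounded_spiralLL _ _).
by move=> /=; lia.
Qed.
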